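(* Let $X$ be an ultrabarrelled topological sequence space (over $\mathbb{K}=\mathbb{R}$ or $\mathbb{C}$) in which $(e_n)_{n=1}^{\infty}$ forms a basis. Suppose that the unweighted unilateral backward shift $T$, given by $$T(u_1,u_2,u_3,\cdots)=(u_2,u_3,u_4,\cdots),$$ is a continuous linear operator on $X$ (in particular $T$ maps $X$ into $X$). Then $T$ is mixing if and only if $\lim_{n\to\infty}e_n=0$ in $X$.
   Context: $\mathbb{K}$ is $\mathbb{R}$ or $\mathbb{C}$; $\mathbb{N}^{\ast}$ is the set of positive integers; $\mathbb{K}^{\mathbb{N}^{\ast}}$ is the vector space of all scalar sequences $(u_n)_{n=1}^{\infty}$. For $n\geq 1$, $e_n$ is the sequence whose $n$-th term is $1$ and all other terms are $0$. A topological vector space is a vector space over $\mathbb{K}$ with a topology making addition and scalar multiplication continuous (such a topology is called a vector topology). A topological sequence space is a topological vector space $X$ that is a linear subspace of $\mathbb{K}^{\mathbb{N}^{\ast}}$ and in which convergence implies coordinatewise convergence (convergence of nets, i.e. each coordinate functional $(u_k)_{k}\mapsto u_n$ is continuous on $X$). Let $\mathfrak{T},\mathfrak{T}'$ be vector topologies for a vector space $X$. $\mathfrak{T}'$ is $F$ linked to $\mathfrak{T}$ if $\mathfrak{T}'$ has a local base of neighborhoods of $0$ each of which is $\mathfrak{T}$-closed. A topological vector space $(X,\mathfrak{T})$ is ultrabarrelled if $\mathfrak{T}$ is larger than (i.e. contains) every vector topology $\mathfrak{T}'$ on $X$ which is $F$ linked to $\mathfrak{T}$. (Local convexity is not assumed.)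 A sequence $(\mu_n)_{n=1}^{\infty}$ in a topological vector space $X$ is a basis if every $\mu\in X$ has a unique representation $\mu=\sum_{n=1}^{\infty}\alpha_n\mu_n$ (convergence in $X$) with scalars $\alpha_n\in\mathbb{K}$. (In particular $e_n\in X$ for all $n$ when $(e_n)$ is a basis of $X$.) A continuous linear operator $S$ on a topological vector space $X$ is mixing if for any pair $U,V$ of nonempty open subsets of $X$ there is a nonnegative integer $N$ such that $S^n(U)\cap V\neq\emptyset$ for all $n\geq N$. *)

(* Defs.v *)
From HB Require Import structures.
From mathcomp Require Import all_boot all_order all_algebra.
From mathcomp Require Import all_classical all_reals all_analysis.

Set Implicit Arguments.
Unset Strict Implicit.
Unset Printing Implicit Defensive.

Import Order.TTheory GRing.Theory Num.Theory.
Import numFieldNormedType.Exports.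

Local Open Scope classical_set_scope.
Local Open Scope ring_scope.

(* Sequences are indexed from 0: the mathematical term u_(n+1) is u n.
   SubLmodule makes the injection val : X -> (nat -> K) linear with range S,
   which forces S to be a linear subspace of nat -> K. *)
HB.mixin Record TopologicalLmodule_isTopologicalSeqSpace
    (K : numFieldType) (S : pred (nat -> K)) X
    & GRing.SubLmodule K S X & TopologicalLmodule K X := {
  coordinate_continuous :
    forall n : nat, continuous (fun u : X => (val u : nat -> K) n)
}.

#[short(type="topologicalSeqSpaceType")]
HB.structure Definition TopologicalSeqSpace
    (K : numFieldType) (S : pred (nat -> K)) :=
  {X of GRing.SubLmodule K S X & TopologicalLmodule K X
      & TopologicalLmodule_isTopologicalSeqSpace K S X}.

(* Vector topologies on a fixed K-vector space are compared with one another,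
   so they are represented by their families of open sets. *)
Record vector_topology (K : numFieldType) (V : lmodType K)
    (tau : set (set V)) : Prop := VectorTopology {
  vtop_setT : tau setT;
  vtop_setI : forall A B, tau A -> tau B -> tau (A `&` B);
  vtop_bigcup : forall F : set (set V),
    F `<=` tau -> tau (\bigcup_(A in F) A);
  vtop_add : forall (x y : V) (W : set V), tau W -> W (x + y) ->
    exists A B : set V, [/\ tau A, tau B, A x, B y &
      forall a b, A a -> B b -> W (a + b)];
  vtop_scale : forall (k : K) (x : V) (W : set V), tau W -> W (k *: x) ->
    exists (A : set K) (B : set V), [/\ open A, tau B, A k, B x &
      forall a b, A a -> B b -> W (a *: b)]
}.

Lemma open_vector_topology (K : numFieldType) (X : topologicalLmodType K) :
  vector_topology (@open X).
Proof.
split.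
- exact: openT.
- by move=> A B; exact: openI.
- by move=> F FO; apply: bigcup_open => A /FO.
- move=> x y W oW Wxy.
  have /(_ W) := @add_continuous X (x, y).
  case=> [|[A B]/= [+ +] AB]; first exact: open_nbhs_nbhs.
  rewrite !nbhsE /= => -[A' [oA' A'x] A'A] [B' [oB' B'y] B'B].
  exists A', B'; split=> // a b /A'A Aa /B'B Bb.
  exact: (AB (a, b)).
- move=> k x W oW Wkx.
  have /(_ W) := @scale_continuous K X (k, x).
  case=> [|[A B]/= [+ +] AB]; first exact: open_nbhs_nbhs.
  rewrite (@nbhsE K) (@nbhsE X) /= => -[A' [oA' A'x] A'A] [B' [oB' B'y] B'B].
  exists A', B'; split=> // a b /A'A Aa /B'B Bb.
  exact: (AB (a, b)).
Qed.

Definition nbhd_of (V : Type) (tau : set (set V)) (x : V) : set (set V) :=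
  [set A | exists W, [/\ tau W, W x & W `<=` A]].

Definition F_linked (K : numFieldType) (V : lmodType K)
    (tau' tau : set (set V)) : Prop :=
  exists B : set (set V), [/\ B `<=` nbhd_of tau' 0,
    forall A, nbhd_of tau' 0 A -> exists2 C, B C & C `<=` A &
    forall C, B C -> tau (~` C)].

Definition ultrabarrelled (K : numFieldType) (X : topologicalLmodType K) :
    Prop :=
  forall tau' : set (set X),
    vector_topology tau' -> F_linked tau' (@open X) -> tau' `<=` @open X.

Definition is_basis (K : numFieldType) (X : topologicalLmodType K)
    (mu : nat -> X) : Prop :=
  forall x : X, exists! a : nat -> K,
    series (fun n => a n *: mu n) @ \oo --> x.

Definition mixing (X : topologicalType) (S : X -> X) : Prop :=
  forall U V : set X, open U -> open V -> U !=set0 -> V !=set0 ->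
    exists N : nat, forall n : nat, (N <= n)%N ->
      (iter n S @` U) `&` V !=set0.

Definition unit_seq (K : numFieldType) (n : nat) : nat -> K :=
  fun k => (k == n)%:R.

Definition backward_shift (K : numFieldType) (u : nat -> K) : nat -> K :=
  fun k => u k.+1.

(* Main.v *)
Require Import Defs.
From HB Require Import structures.
From mathcomp Require Import all_boot all_order all_algebra.
From mathcomp Require Import all_classical all_reals all_analysis.
From mathcomp Require Import complex.

Set Implicit Arguments.
Unset Strict Implicit.
Unset Printing Implicit Defensive.

Import Order.TTheory GRing.Theory Num.Theory.
Import numFieldNormedType.Exports.

Local Open Scope classical_set_scope.
Local Open Scope ring_scope.

(** If [e n] tends to [0], mixing follows as for every operator with a dense set of
vectors killed by some power of it and a right inverse whose powers tend to [0]
pointwise.  The finite sums of multiples of the [e n] are dense because [e] is a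
basis.  Given such sums [s] and [t] in two open sets, let [r n] be [t] shifted
[n] places to the right.  Then [r n] tends to [0], so [s + r n] stays in the
first open set, and for large [n] the [n]th power of the backward shift kills
[s] and sends [r n] to [t] ([cvg0_mixing]).

For the converse, the basis expansion of [u] is the sum of the terms
[coord n u *: e n], so these terms tend to [0] and are in particular bounded.
The space being ultrabarrelled, a Banach-Steinhaus argument makes the maps
[u |-> coord n u *: e n] equicontinuous ([ultrabarrelled_equicontinuous]): for
every neighbourhood [W] of [0] there is a neighbourhood of [0] whose members [u]
have all their terms in [W].  By mixing, for every large [n], some such [u] is
sent by the [n]th power of the shift to a vector whose leading coordinate, which
is [coord n u], is close to [1].  Dividing [coord n u *: e n] by that coordinate
shows that [e n] is small ([mixing_cvg0]). *)

(** * Limits and neighbourhoods of zero in a topological vector space *)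

Section TopologicalLmoduleLimits.
Context {K : numFieldType} {X : topologicalLmodType K}.
Context {I : Type} {F : set_system I} {FF : Filter F}.

Lemma tvs_cvgD (f g : I -> X) (x y : X) :
  f @ F --> x -> g @ F --> y -> (f i + g i) @[i --> F] --> x + y.
Proof.
move=> fx gy; apply: continuous2_cvg fx gy.
exact: (@add_continuous X (x, y)).
Qed.

Lemma tvs_cvgB (f g : I -> X) (x y : X) :
  f @ F --> x -> g @ F --> y -> (f i - g i) @[i --> F] --> x - y.
Proof.
move=> fx gy.
apply: (@continuous2_cvg _ X X X F FF f g (fun a b => a - b) x y _ fx gy).
exact: (@sub_continuous X (x, y)).
Qed.

Lemma tvs_cvgZ (k : I -> K) (f : I -> X) (c : K) (x : X) :
  k @ F --> c -> f @ F --> x -> (k i *: f i) @[i --> F] --> c *: x.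
Proof.
move=> kc fx.
apply: (@continuous2_cvg _ K X X F FF k f (fun a b => a *: b) c x _ kc fx).
exact: (@scale_continuous K X (c, x)).
Qed.

Lemma tvs_cvg_sum (f : nat -> I -> X) (x : nat -> X) (n : nat) :
  (forall k, f k @ F --> x k) ->
  (\sum_(0 <= k < n) f k i) @[i --> F] --> \sum_(0 <= k < n) x k.
Proof.
move=> fx; elim: n => [|n IHn].
  rewrite big_geq//; under eq_fun do rewrite big_geq//; exact: cvg_cst.
rewrite big_nat_recr//=; under eq_fun do rewrite big_nat_recr//=.
exact: tvs_cvgD.
Qed.

End TopologicalLmoduleLimits.

Section NeighbourhoodsOfZero.
Context {K : numFieldType} {X : topologicalLmodType K}.
Implicit Types U : set X.

Lemma nbhs0_add U : nbhs 0 U ->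
  exists2 V : set X, nbhs 0 V & forall a b, V a -> V b -> U (a + b).
Proof.
move=> U0; have : nbhs ((0 : X) + 0) U by rewrite addr0.
move=> /(@add_continuous X (0, 0))[[A B]/= [A0 B0] AB].
exists (A `&` B); first exact: filterI.
by move=> a b [Aa _] [_ Bb]; apply: (AB (a, b)).
Qed.

Lemma nbhs0_sub U : nbhs 0 U ->
  exists2 V : set X, nbhs 0 V & forall a b, V a -> V b -> U (a - b).
Proof.
move=> U0; have : nbhs ((0 : X) - 0) U by rewrite subr0.
move=> /(@sub_continuous X (0, 0))[[A B]/= [A0 B0] AB].
exists (A `&` B); first exact: filterI.
by move=> a b [Aa _] [_ Bb]; apply: (AB (a, b)).
Qed.

Lemma nbhs0_scale U (c : K) : nbhs 0 U ->
  exists (A : set K) (V : set X), [/\ nbhs c A, nbhs 0 V &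
    forall k u, A k -> V u -> U (k *: u)].
Proof.
move=> U0; have : nbhs (c *: (0 : X)) U by rewrite scaler0.
move=> /(@scale_continuous K X (c, 0))[[A B]/= [A0 B0] AB].
by exists A, B; split=> // k u Ak Bu; apply: (AB (k, u)).
Qed.

(** If [V - V] is inside [U] then so is the closure of [V]: a point [y] adherent
to [V] has some [z] of [V] with [z - y] in [V], and [y = z - (z - y)]. *)
Lemma nbhs0_closed U : nbhs 0 U ->
  exists V, [/\ nbhs 0 V, closed V & V `<=` U].
Proof.
move=> /nbhs0_sub[V V0 VU]; exists (closure V); split.
- by apply: filterS V0; exact: subset_closure.
- exact: closed_closure.
move=> y /(_ [set z | V (z - y)])[|z [Vz Vzy]].
  have /(_ V)/= : (z - y) @[z --> y] --> y - y.
    by apply: tvs_cvgB; [exact: cvg_id|exact: cvg_cst].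
  by rewrite subrr => /(_ V0).
by have := VU _ _ Vz Vzy; rewrite opprB addrC subrK.
Qed.

(** A tail of the sequence lies in a neighbourhood absorbed uniformly by small
scalars; each of the finitely many remaining terms is absorbed separately. *)
Lemma cvg0_bounded (x : nat -> X) U : x @ \oo --> (0 : X) -> nbhs 0 U ->
  \forall k \near (0 : K), forall n, U (k *: x n).
Proof.
move=> x0 U0; have [A [V [A0 V0 AVU]]] := nbhs0_scale 0 U0.
have [N _ xV] := x0 _ V0.
have head : \forall k \near (0 : K), forall n : 'I_N, U (k *: x n).
  apply: (@filter_forall _ _ (fun (n : 'I_N) k => U (k *: x n))
            (nbhs (0 : K)) _) => n.
  have /(_ U)/= : (k *: x n) @[k --> (0 : K)] --> 0 *: x n.
    by apply: (tvs_cvgZ (F := nbhs (0 : K))); [exact: cvg_id|exact: cvg_cst].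
  by rewrite scale0r => /(_ U0).
apply: filterS2 A0 head => k Ak Uk n.
have [Nn|nN] := leqP N n; first exact/AVU/xV.
exact: (Uk (Ordinal nN)).
Qed.

End NeighbourhoodsOfZero.

(** * The Banach-Steinhaus theorem in ultrabarrelled spaces *)

Section BanachSteinhaus.
Context {K : numFieldType} {X Y : topologicalLmodType K} {J : Type}.
Variable f : J -> {linear X -> Y}.

Definition family_preimage (U : set Y) : set X := [set u | forall i, U (f i u)].

(** The coarsest translation-invariant topology for which the linear maps [f i]
are equicontinuous: a base of neighbourhoods of [0] is given by the sets
[family_preimage U].  Its members are all open for the original topology exactly
when the family is equicontinuous. *)
Definition family_topology : set (set X) :=
  [set O | forall x, O x ->
    exists2 U, nbhs 0 U & forall u, family_preimage U u -> O (x + u)].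

(** Translates of [family_preimage U] need not be members of [family_topology], so
open sets around a point have to be extracted from them. *)
Lemma family_topology_translate (x : X) (U : set Y) : nbhs 0 U ->
  exists O, [/\ family_topology O, O x &
    forall y, O y -> family_preimage U (y - x)].
Proof.
move=> U0.
(* The interior of the translate of [family_preimage U] by [x]. *)
exists [set y | exists2 V, nbhs 0 V &
  forall u, family_preimage V u -> family_preimage U (y - x + u)]; split.
- move=> y [V V0 VU]; have [W W0 WV] := nbhs0_add V0.
  exists W => // u Wu; exists W => // v Wv.
  rewrite (addrAC y) -(addrA (y - x)); apply: (VU (u + v)) => i.
  by rewrite linearD; exact: WV.
- by exists U => // u; rewrite subrr add0r.
- move=> y [V V0 VU]; rewrite -[y - x]addr0; apply: (VU 0) => i.
  by rewrite linear0; exact: nbhs_singleton.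
Qed.

Hypothesis f_bounded : forall u (U : set Y), nbhs 0 U ->
  \forall k \near (0 : K), forall i, U (k *: f i u).

(** Pointwise boundedness is what makes scalar multiplication continuous in its
scalar argument: in [a *: b - k *: x = (a - k) *: x + a *: (b - x)] the first
term has to be small along the whole family as soon as [a] is close to [k]. *)
Lemma family_vector_topology : vector_topology family_topology.
Proof.
split.
- by move=> x _; exists setT => //; exact: filterT.
- move=> A B tA tB x [/tA[U U0 UA] /tB[V V0 VB]].
  exists (U `&` V); first exact: filterI.
  move=> u UVu; split; [apply: UA|apply: VB] => i; by case: (UVu i).
- move=> F tF x [A FA /(tF _ FA)[U U0 UA]]; exists U => // u Uu.
  by exists A => //; exact: UA.
- move=> x y W tW /tW[U U0 UW]; have [V V0 VU] := nbhs0_add U0.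
  have [A [tA Ax AV]] := family_topology_translate x V0.
  have [B [tB By BV]] := family_topology_translate y V0.
  exists A, B; split=> // a b /AV Va /BV Vb.
  have -> : a + b = x + y + ((a - x) + (b - y)).
    by rewrite addrACA [x + _]addrC [y + _]addrC !subrK.
  by apply: UW => i; rewrite linearD; exact: VU.
- move=> k x W tW /tW[U U0 UW]; have [V V0 VU] := nbhs0_add U0.
  have [A1 [V' [A10 V'0 AV']]] := nbhs0_scale k V0.
  have A2 : nbhs k [set c | forall i, V ((c - k) *: f i x)].
    have /(_ _ (f_bounded x V0))/= : (c - k) @[c --> k] --> (0 : K).
      by rewrite -(subrr k); apply: (@cvgB _ _ _ (nbhs k) _ id (fun=> k));
        [exact: cvg_id|exact: cvg_cst].
    exact.
  have : nbhs k (A1 `&` [set c | forall i, V ((c - k) *: f i x)]).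
    exact: filterI.
  rewrite (@nbhsE K) => -[A [oA Ak] AA].
  have [B [tB Bx BV]] := family_topology_translate x V'0.
  exists A, B; split=> // a b /AA[A1a Va] /BV V'b.
  have -> : a *: b = k *: x + ((a - k) *: x + a *: (b - x)).
    by rewrite addrA -scalerDl [k + _]addrC subrK -scalerDr [x + _]addrC subrK.
  apply: UW => i; rewrite linearD !linearZZ; apply: VU; first exact: Va.
  exact: AV'.
Qed.

Hypothesis f_continuous : forall i, continuous (f i).

(** When [U] is closed, [family_preimage U] is an intersection of preimages of
[U] by continuous maps, hence closed, and closed [U] suffice for a base. *)
Lemma family_topology_F_linked : F_linked family_topology (@open X).
Proof.
exists [set C | exists U, [/\ nbhs 0 U, closed U & C = family_preimage U]].
split.
- move=> _ [U [U0 _ ->]]; have [W [tW W0 WU]] := family_topology_translate 0 U0.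
  by exists W; split=> // y /WU; rewrite subr0.
- move=> A [W [tW W0 WA]]; have [U U0 UW] := tW _ W0.
  have [V [V0 cV VU]] := nbhs0_closed U0.
  exists (family_preimage V); first by exists V.
  by move=> u Vu; apply: WA; rewrite -[u]add0r; apply: UW => i; exact/VU/Vu.
- move=> _ [U [U0 cU ->]]; apply: closed_openC.
  have -> : family_preimage U = \bigcap_i (f i @^-1` U).
    by apply/seteqP; split=> [u Uu i _|u Uu i]; [exact: Uu|exact: (Uu i I)].
  by apply: closed_bigI => i _; exact: preimage_closed.
Qed.

Lemma ultrabarrelled_equicontinuous (U : set Y) : ultrabarrelled X ->
  nbhs 0 U -> \forall u \near (0 : X), forall i, U (f i u).
Proof.
move=> hX U0; have [W [tW W0 WU]] := family_topology_translate 0 U0.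
have oW : open W := hX _ family_vector_topology family_topology_F_linked _ tW.
have : nbhs (0 : X) W by exact: open_nbhs_nbhs.
by apply: filterS => u /WU; rewrite subr0.
Qed.

End BanachSteinhaus.

(** * The backward shift on a sequence space with basis of unit vectors *)

Section UnitVectorBasis.
Context {K : numFieldType} {S : pred (nat -> K)}.
Context {X : topologicalSeqSpaceType S}.

(** Typed in [K^o], the regular module, so that it is a linear map. *)
Definition coord (n : nat) (u : X) : K^o := (val u : nat -> K) n.

Lemma coord_is_linear n : linear (coord n).
Proof. by move=> a u v; rewrite /coord linearP. Qed.

HB.instance Definition _ n :=
  GRing.isLinear.Build K X K^o *:%R (coord n) (coord_is_linear n).

Lemma coord_inj (u v : X) : (forall n, coord n u = coord n v) -> u = v.
Proof. by move=> uv; apply: val_inj; apply/funext. Qed.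

Definition coord_term (n : nat) (mu u : X) : X := coord n u *: mu.

Lemma coord_term_is_linear n mu : linear (coord_term n mu).
Proof. by move=> a u v; rewrite /coord_term linearP scalerDl -scalerA. Qed.

HB.instance Definition _ n mu :=
  GRing.isLinear.Build K X X *:%R (coord_term n mu) (coord_term_is_linear n mu).

Lemma coord_term_continuous n mu : continuous (coord_term n mu).
Proof.
move=> u; apply: tvs_cvgZ; last exact: cvg_cst.
exact: coordinate_continuous.
Qed.

Variable e : nat -> X.
Hypothesis he : forall n, val (e n) = unit_seq K n.

Lemma coord_e n k : coord k (e n) = (k == n)%:R.
Proof. by rewrite /coord he. Qed.

Lemma coord_lincomb (a : nat -> K) (mu : nat -> X) n k :
  coord k (\sum_(0 <= j < n) a j *: mu j) =
  \sum_(0 <= j < n) a j * coord k (mu j).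
Proof. by rewrite linear_sum; apply: eq_bigr => j _; rewrite linearZZ. Qed.

Lemma coord_series (a : nat -> K) n k :
  coord k (series (fun n => a n *: e n) n) = if (k < n)%N then a k else 0.
Proof.
rewrite /series/= coord_lincomb big_mkord.
under eq_bigr => j _ do rewrite coord_e mulr_natr mulrb.
rewrite -big_mkcond/=; case: ifPn => kn.
  by rewrite (big_pred1 (Ordinal kn))// => j /=; rewrite eq_sym -val_eqE.
by rewrite big_pred0// => j; apply: contraNF kn => /eqP ->.
Qed.

Hypothesis e_basis : is_basis e.

(** The coefficients of an expansion are the coordinates of the vector: the
[k]th coordinate of the partial sums is eventually the [k]th coefficient, and
coordinates are continuous with values in a Hausdorff space. *)
Lemma basis_series (u : X) : series (fun n => coord n u *: e n) @ \oo --> u.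
Proof.
have [a [au _]] := e_basis u.
suff -> : (fun n => coord n u *: e n) = (fun n => a n *: e n) by [].
apply/funext => k; congr (_ *: _).
have ak : coord k (series (fun n => a n *: e n) n) @[n --> \oo] --> a k.
  apply: cvg_near_cst; exists k.+1 => // n /= kn.
  by rewrite coord_series kn.
apply: (cvg_unique _ _ ak); first exact: norm_hausdorff.
exact: (cvg_comp _ _ au (@coordinate_continuous K S X k u)).
Qed.

(** The terms are the differences of consecutive partial sums. *)
Lemma coord_term_cvg0 (u : X) : coord_term n (e n) u @[n --> \oo] --> (0 : X).
Proof.
have su := @basis_series u.
have -> : (fun n => coord_term n (e n) u) =
   (fun n => series (fun n => coord n u *: e n) (n + 1)%N
             - series (fun n => coord n u *: e n) n).
  by apply/funext => n; rewrite addn1 seriesSB.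
rewrite -(subrr u).
by apply: tvs_cvgB => //; exact: cvg_comp (@cvg_addnr 1) su.
Qed.

Lemma coord_iter_shift (T : X -> X) :
  (forall u, val (T u) = backward_shift (val u)) ->
  forall n u k, coord k (iter n T u) = coord (n + k) u.
Proof.
move=> hT n u; elim: n => [//|n IHn] k.
by rewrite iterS addSnnS -IHn /coord hT.
Qed.

(** Equicontinuity of the terms [coord n u *: e n] gives a neighbourhood of [0]
on which they are uniformly small; mixing finds in it vectors whose [n]th
coordinate is close to [1], for every large [n]. *)
Lemma mixing_cvg0 (T : X -> X) : ultrabarrelled X ->
  (forall u, val (T u) = backward_shift (val u)) ->
  mixing T -> e @ \oo --> (0 : X).
Proof.
move=> hX hT mixT U U0.
have [A [W [A1 W0 AWU]]] : exists (A : set K) (W : set X), [/\ nbhs (1 : K) A,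
    nbhs (0 : X) W & forall c w, A c -> W w -> U (c^-1 *: w)].
  have [B [W [B1 W0 BWU]]] := nbhs0_scale (1^-1) U0.
  exists [set c | B c^-1], W; split=> //.
    exact: (inv_continuous (oner_neq0 K)).
  by move=> c w; exact: BWU.
(* A nonzero coordinate is needed to recover [e n] from its multiple. *)
pose A' := A `&` [set c | c != 0].
have A'1 : nbhs (1 : K) A'.
  apply: filterI => //.
  exact: (@cvgr_neq0 _ K K (nbhs (1 : K)) _ id 1 cvg_id (oner_neq0 K)).
have equi : \forall u \near (0 : X), forall n, W (coord_term n (e n) u).
  apply: (ultrabarrelled_equicontinuous
            (f := fun n => coord_term n (e n))) => //.
    by move=> u B B0; apply: cvg0_bounded B0; exact: coord_term_cvg0.
  by move=> n; exact: coord_term_continuous.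
have [||||N mixN] := mixT
    [set u | forall n, W (coord_term n (e n) u)]°
    [set v | A' (coord 0 v)]°.
- exact: open_interior.
- exact: open_interior.
- by exists 0.
- exists (e 0%N); apply: coordinate_continuous.
  by rewrite -/(coord 0 _) coord_e.
exists N => // n /mixN[_ [[u /interior_subset/(_ n) Wu <-]]].
move=> /interior_subset[/=]; rewrite coord_iter_shift// addn0 => Aun un0.
have := AWU _ _ Aun Wu.
by rewrite /coord_term scalerA mulVf// scale1r.
Qed.

(** The vector [s + r n] is near [s], and its image by the [n]th power of the
shift is exactly [t], because [s] has only finitely many nonzero coordinates. *)
Lemma cvg0_mixing (T : X -> X) :
  (forall u, val (T u) = backward_shift (val u)) ->
  e @ \oo --> (0 : X) -> mixing T.
Proof.
move=> hT e0 U V oU oV [u Uu] [v Vv].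
have [p _ /(_ p (leqnn p))/= Us] :=
  basis_series (open_nbhs_nbhs (conj oU Uu)).
have [q _ /(_ q (leqnn q))/= Vt] :=
  basis_series (open_nbhs_nbhs (conj oV Vv)).
move: Us Vt; set s := series _ p; set t := series _ q => Us Vt.
pose r n := \sum_(0 <= j < q) coord j v *: e (j + n)%N.
have sr : s + r n @[n --> \oo] --> s.
  rewrite -[X in _ --> X]addr0; apply: tvs_cvgD; first exact: cvg_cst.
  have -> : 0 = \sum_(0 <= j < q) coord j v *: 0 :> X.
    by rewrite big1// => j _; rewrite scaler0.
  apply: tvs_cvg_sum => j; apply: tvs_cvgZ; first exact: cvg_cst.
  exact: cvg_comp (@cvg_addnl j) e0.
have [N _ NU] := sr _ (open_nbhs_nbhs (conj oU Us)).
exists (maxn N p) => n; rewrite geq_max => /andP[Nn pn].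
exists t; split=> //; exists (s + r n); first exact: NU.
apply: coord_inj => k; rewrite coord_iter_shift// linearD/= coord_series.
rewrite ltnNge (leq_trans pn (leq_addr _ _)) add0r /t /series/= !coord_lincomb.
by apply: eq_bigr => j _; rewrite !coord_e addnC eqn_add2r.
Qed.

End UnitVectorBasis.

Theorem theorem1p5 (R : realType) (K : numFieldType)
  (hK : K = (R : numFieldType) \/ K = (R[i]%C : numFieldType))
  (S : pred (nat -> K)) (X : topologicalSeqSpaceType S)
  (hX : ultrabarrelled X)
  (e : nat -> X) (he : forall n : nat, val (e n) = unit_seq K n)
  (hbasis : is_basis e)
  (T : {linear X -> X}) (hT : forall u : X, val (T u) = backward_shift (val u))
  (hTc : continuous T) :
  mixing T <-> e @ \oo --> (0 : X).
Proof. by split; [exact: mixing_cvg0|exact: cvg0_mixing]. Qed.
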